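(* There is a randomized algorithm (always returning the correct answer) for rooted Subtree Isomorphism on binary trees which, for rooted binary trees $H$ and $G$ with $O(n)$ vertices and height at most $h$, runs in expected time $O(\min\{2.8431^h, n^2\})$. In particular, it runs in expected time $O(n^{1.507})$ for trees of height $(1+o(1))\log_2 n$, and in expected truly subquadratic time (i.e. $O(n^{2-\delta})$ for some constant $\delta>0$) for trees of height $h\leq 1.3267\log_2 n$.
   Context: A rooted binary tree is a rooted tree in which every vertex has at most $2$ children. Rooted Subtree Isomorphism: given rooted unordered trees $H$ and $G$, decide whether $H$ is isomorphic to a subtree of $G$, i.e. whether there is an injective map $f$ from the vertices of $H$ to the vertices of $G$ with $f(\mathrm{root}(H))=\mathrm{root}(G)$ such that whenever $c$ is a child of $p$ in $H$, $f(c)$ is a child of $f(p)$ in $G$. The height of a rooted tree is the maximum number of edges on a root-to-leaf path.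
   Formalization: The exponent 1.507 is read as rounded: the bound is O(n^c) for a fixed constant c with |c-1.507|<0.0005, because 2.8431^(log2 n)=n^(1.50746...) is not O(n^1.507), so the exact exponent 1.507 does not follow from the main bound as claimed. *)

(* Defs.v *)
From HB Require Import structures.
From mathcomp Require Import all_boot all_order all_algebra.
From mathcomp Require Import all_classical all_reals all_analysis.

Set Implicit Arguments.
Unset Strict Implicit.
Unset Printing Implicit Defensive.

Import Order.TTheory GRing.Theory Num.Theory.
Import numFieldNormedType.Exports.

Local Open Scope ring_scope.

(** * Rooted trees *)

(* A finite unordered rooted tree on the vertices 0, ..., nverts - 1, given by
   its parent map; [reaches_root] makes it connected and acyclic, and forces
   every vertex other than the root to have a parent. *)
Record rtree := RTree {
  nverts : nat;
  tree_root : 'I_nverts;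
  parent : 'I_nverts -> option 'I_nverts;
  root_orphan : parent tree_root = None;
  reaches_root : forall v : 'I_nverts,
    exists k : nat, iter k (obind parent) (Some v) == Some tree_root
}.

Definition children (T : rtree) (v : 'I_(nverts T)) : seq 'I_(nverts T) :=
  [seq c <- enum 'I_(nverts T) | parent c == Some v].

Definition binary (T : rtree) : Prop :=
  forall v : 'I_(nverts T), (size (children v) <= 2)%N.

Definition depth (T : rtree) (v : 'I_(nverts T)) : nat :=
  ex_minn (reaches_root v).

Definition leaf (T : rtree) (v : 'I_(nverts T)) : bool := nilp (children v).

Definition height (T : rtree) : nat :=
  (\max_(v < nverts T | leaf v) depth v)%N.

Definition subtree_iso (H G : rtree) : Prop :=
  exists f : 'I_(nverts H) -> 'I_(nverts G),
    [/\ injective f,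
        f (tree_root H) = tree_root G
      & forall p c : 'I_(nverts H), c \in children p -> f c \in children (f p)].

(** * Randomized random-access machine *)

(* Unit-cost RAM with a random-bit instruction.  Its only arithmetic is +1 and
   -1, so after t steps every value is at most t plus the maximum of the input
   values and the constants of the program: a run of polynomial length only
   uses words of O(log n) bits, hence is also a run of a word RAM. *)
Inductive instr : Type :=
  | Const of nat & nat        (* Const r k: r := k *)
  | Move of nat & nat         (* Move r s: r := s *)
  | Incr of nat               (* Incr r: r := r + 1 *)
  | Decr of nat               (* Decr r: r := r - 1, truncated at 0 *)
  | Read of nat & nat         (* Read r s: r := mem[s] *)
  | Write of nat & nat        (* Write r s: mem[r] := s *)
  | JumpEq of nat & nat & nat (* JumpEq r s l: go to l if r = s *)
  | Flip of nat               (* Flip r: r := uniformly random bit *)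
  | Answer of bool.           (* halt with this answer *)

Definition program : Type := seq instr.

Record config : Type := Config {
  pc : nat;
  regs : nat -> nat;
  memory : nat -> nat
}.

Definition upd (f : nat -> nat) (a x : nat) : nat -> nat :=
  fun b => if b == a then x else f b.

(* One step, [coin] being the random bit available to it; the left summand
   contains the running states and the right one the answers.  A jump or a
   fall outside the program rejects. *)
Definition step (P : program) (coin : bool) (s : config + bool) :
    config + bool :=
  match s with
  | inr b => inr b
  | inl (Config i r m) =>
    match nth (Answer false) P i with
    | Const x k => inl (Config i.+1 (upd r x k) m)
    | Move x y => inl (Config i.+1 (upd r x (r y)) m)
    | Incr x => inl (Config i.+1 (upd r x (r x).+1) m)
    | Decr x => inl (Config i.+1 (upd r x (r x).-1) m)
    | Read x y => inl (Config i.+1 (upd r x (m (r y))) m)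
    | Write x y => inl (Config i.+1 r (upd m (r x) (r y)))
    | JumpEq x y l => inl (Config (if r x == r y then l else i.+1) r m)
    | Flip x => inl (Config i.+1 (upd r x coin) m)
    | Answer b => inr b
    end
  end.

(* The state after t steps on the coin sequence w.  Step number i may use the
   coin [w i]; coins of steps that do not execute [Flip] are discarded. *)
Definition run (P : program) (w : nat -> bool) (t : nat) (c : config) :
    config + bool :=
  iteri t (fun i s => step P (w i) s) (inl c).

Definition halted (s : config + bool) : bool :=
  if s is inr _ then true else false.

Definition halts_at (P : program) (w : nat -> bool) (c : config) (t : nat) :
    bool :=
  halted (run P w t c) && ~~ halted (run P w t.-1 c).

(* Whether a run takes exactly t steps depends only on its first t coins. *)
Definition prob_time (R : realType) (P : program) (c : config) (t : nat) : R :=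
  #|[set w : t.-tuple bool | halts_at P (nth false w) c t]|%:R / 2 ^+ t.

(* This is the expected running time of programs that halt with probability 1. *)
Definition expected_time (R : realType) (P : program) (c : config) : \bar R :=
  (\sum_(0 <= t <oo) (t%:R * prob_time R P c t)%:E)%E.

(** * Input format *)

(* Stored from address b on, vertex v is a record of two consecutive cells
   containing the addresses of the records of its children (0 if absent). *)
Definition addr (b v : nat) : nat := (b + 2 * v)%N.

Definition child_ptr (b : nat) (T : rtree) (v : 'I_(nverts T)) (i : nat) : nat :=
  nth 0%N [seq addr b (nat_of_ord c) | c <- children v] i.

Definition cells (b : nat) (T : rtree) : seq nat :=
  flatten [seq [:: child_ptr b v 0; child_ptr b v 1] | v <- enum 'I_(nverts T)].

(* Memory: unused cell 0, then H, then G, then zeros.  Registers 0, 1 and 2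
   contain the addresses of the two roots and of the first free cell. *)
Definition init (H G : rtree) : config :=
  let bH := 1%N in
  let bG := addr bH (nverts H) in
  let free := addr bG (nverts G) in
  Config 0
    (nth 0%N [:: addr bH (tree_root H); addr bG (tree_root G); free])
    (nth 0%N (0%N :: cells bH H ++ cells bG G)).

(** * The problem *)

Definition always_correct (P : program) : Prop :=
  forall H G : rtree, binary H -> binary G ->
  forall w : nat -> bool, exists (t : nat) (b : bool),
    run P w t (init H G) = inr b /\ (b <-> subtree_iso H G).

(* Binary trees with O(n) vertices, K being the implied constant. *)
Definition instance (K n : nat) (H G : rtree) : Prop :=
  [/\ binary H, binary G, (nverts H <= K * n)%N & (nverts G <= K * n)%N].

Definition log2 (R : realType) (x : R) : R := ln x / ln 2.

(* The number i.d1...dk in decimal notation, for ds = [:: d1; ...; dk]. *)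
Definition decimal (R : realType) (i : nat) (ds : seq nat) : R :=
  i%:R + foldr (fun d x => (d%:R + x) / 10) 0 ds.

(* Main.v *)
(** Compare the children a, b of a vertex of H with the children c, d of a
    vertex of G, treating absent children as empty trees: the subtree of the
    former embeds into that of the latter iff (ac and bd) or (ad and bc).  A pair
    of vertices is only reached from the pair of their parents, so the recursion
    visits every pair at most once and takes quadratic time in the worst case,
    without memoization.  It is the lazy evaluation of a read-once AND/OR
    formula of depth 2h, and exchanging a with b and c with d by two independent
    coins evaluates both the disjuncts and the conjuncts in random order.  As in
    the analysis of Saks and Wigderson, the expected cost is then
    O(((1 + sqrt 33) / 4)^(2h)), where ((1 + sqrt 33) / 4)^2 = 2.84307... *)
Require Import Defs.
From mathcomp Require Import all_boot all_order all_algebra.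
From mathcomp Require Import all_classical all_reals all_analysis.
From mathcomp Require Import zify ring lra.

Set Implicit Arguments.
Unset Strict Implicit.
Unset Printing Implicit Defensive.

Import Order.TTheory GRing.Theory Num.Theory.
Import numFieldNormedType.Exports.

Local Open Scope ring_scope.

(** * Expected running time of a program *)

Section HaltsWithin.
Variables (R : realType) (P : program).

(** A derivation is a finite decision tree over the coins: it certifies halting with answer [b] on
    every coin sequence, and [x] bounds the expected number of steps. Deterministic steps also
    average over a coin. *)
Inductive halts_within (b : bool) : config + bool -> R -> Prop :=
  | HaltsNow x : 0 <= x -> halts_within b (inr b) x
  | HaltsStep c x0 x1 x :
      halts_within b (step P false (inl c)) x0 ->
      halts_within b (step P true (inl c)) x1 ->
      1 + (x0 + x1) / 2 <= x -> halts_within b (inl c) x.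

Lemma halts_within_le b s x y :
  halts_within b s x -> x <= y -> halts_within b s y.
Proof.
case=> [{}x x_ge0|c x0 x1 {}x s0 s1 le_x] le_xy.
  by apply: HaltsNow; apply: le_trans le_xy.
exact: HaltsStep s0 s1 (le_trans le_x le_xy).
Qed.

Lemma halts_within_flip b c x y0 y1 :
  halts_within b (step P false (inl c)) (y0 - 1) ->
  halts_within b (step P true (inl c)) (y1 - 1) ->
  (y0 + y1) / 2 <= x -> halts_within b (inl c) x.
Proof. by move=> h0 h1 le_x; apply: HaltsStep h0 h1 _; lra. Qed.

Lemma halts_within_det b c x :
  step P true (inl c) = step P false (inl c) ->
  halts_within b (step P false (inl c)) (x - 1) ->
  halts_within b (inl c) x.
Proof.
by move=> eq_step hx; apply: (halts_within_flip (y0 := x) (y1 := x));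
   rewrite ?eq_step //; lra.
Qed.

Definition run_from (w : nat -> bool) (t : nat) (s : config + bool) :=
  iteri t (fun i s => step P (w i) s) s.

Lemma run_fromSr w t s :
  run_from w t.+1 s = run_from (fun i => w i.+1) t (step P (w 0%N) s).
Proof. by elim: t => //= t <-. Qed.

Lemma halts_within_run b s x : halts_within b s x ->
  forall w, exists t, run_from w t s = inr b.
Proof.
elim=> [y _|c x0 x1 y _ IH0 _ IH1 _] w; first by exists 0%N.
have [t Ht] : exists t,
    run_from (fun i => w i.+1) t (step P (w 0%N) (inl c)) = inr b.
  by case: (w 0%N); [apply: IH1|apply: IH0].
by exists t.+1; rewrite run_fromSr.
Qed.

(** The case [t == 0] lets an already halted state count as halting at time 0, as the recursion on
    the first coin requires; on running states this agrees with [halts_at]. *)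
Definition halts_at_from w s t :=
  halted (run_from w t s) && ((t == 0)%N || ~~ halted (run_from w t.-1 s)).

Fixpoint halt_prob (s : config + bool) (t : nat) : R :=
  if t is t'.+1 then
    if halted s then 0
    else (halt_prob (step P false s) t' + halt_prob (step P true s) t') / 2
  else (halted s)%:R.

Lemma halted_run_from w t s : halted s -> halted (run_from w t s).
Proof. by case: s => // b _; elim: t => //= t; case: (run_from _ _ _). Qed.

Lemma halts_at_fromS w s t : halts_at_from w s t.+1 =
  ~~ halted s && halts_at_from (fun i => w i.+1) (step P (w 0%N) s) t.
Proof.
rewrite /halts_at_from /=.
have [hs|hs] := boolP (halted s).
  by rewrite (halted_run_from w t hs) andbF.
rewrite -[step P (w t) _]/(run_from w t.+1 s) run_fromSr.
by case: t => [|t]; rewrite /= ?hs // -run_fromSr.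
Qed.

Lemma card_tupleS (t : nat) (p : pred (t.+1.-tuple bool)) :
  (#|[set w | p w]| = #|[set w : t.-tuple bool | p [tuple of false :: w]]| +
                  #|[set w : t.-tuple bool | p [tuple of true :: w]]|)%N.
Proof.
rewrite -!sum1dep_card.
rewrite (reindex (fun u : bool * t.-tuple bool => [tuple of u.1 :: u.2])) /=.
  rewrite (eq_bigl (fun u : bool * t.-tuple bool => predT u.1 && p [tuple of u.1 :: u.2])) //.
  by rewrite -(pair_big_dep predT
    (fun (b : bool) (w : t.-tuple bool) => p [tuple of b :: w])
    (fun _ _ => 1%N)) big_bool addnC.
exists (fun w : t.+1.-tuple bool => (thead w, [tuple of behead w])).
  by move=> [b w] _ /=; congr pair; apply: val_inj.
by move=> w _; apply: val_inj; rewrite /= [in RHS](tuple_eta w).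
Qed.

Lemma halt_probE s t :
  #|[set w : t.-tuple bool | halts_at_from (nth false w) s t]|%:R / 2 ^+ t
  = halt_prob s t.
Proof.
elim: t s => [|t IH] s /=.
  rewrite expr0 divr1 /halts_at_from /= andbT; case: (halted s).
    rewrite (_ : [set w | true] = [set: 0.-tuple bool]%SET).
      by rewrite cardsT card_tuple.
    by apply/setP=> w; rewrite !inE.
  by rewrite (_ : [set w | false] = finset.set0) ?cards0 //; apply/setP=> w; rewrite !inE.
rewrite card_tupleS -!IH.
have E b : [set w : t.-tuple bool | halts_at_from (nth false [tuple of b :: w]) s t.+1]
    = if halted s then finset.set0 else
      [set w : t.-tuple bool | halts_at_from (nth false w) (step P b s) t].
  apply/setP=> w; rewrite !inE halts_at_fromS /=.
  by case: (halted s); rewrite !inE.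
rewrite !E; case: (halted s); first by rewrite !cards0 mul0r.
rewrite natrD exprS; field.
by rewrite expf_neq0.
Qed.

Lemma prob_timeE c t : prob_time R P c t = halt_prob (inl c) t.
Proof.
rewrite -halt_probE /prob_time; congr (_%:R / _); apply: eq_card => w.
by rewrite !inE /halts_at /halts_at_from /run; case: t w.
Qed.

Lemma halt_prob_ge0 s t : 0 <= halt_prob s t.
Proof.
elim: t s => [|t IH] s /=; first exact: ler0n.
by case: (halted s) => //; rewrite divr_ge0 // addr_ge0.
Qed.

Lemma sum_halt_prob_le1 n s : \sum_(t < n) halt_prob s t <= 1.
Proof.
elim: n s => [|n IH] s; first by rewrite big_ord0.
rewrite big_ord_recl /=; case: (halted s) => /=.
  by rewrite big1 // addr0.
rewrite add0r -mulr_suml big_split /=.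
have := IH (step P false s); have := IH (step P true s); lra.
Qed.

(** Delaying a run by one step replaces [t] by [t + 1]; the extra term is a total halting
    probability, at most 1, and is paid by the 1 in [HaltsStep]. *)
Lemma sum_halt_time_le b n s x : halts_within b s x ->
  \sum_(t < n) t%:R * halt_prob s t <= x.
Proof.
move=> hs; elim: hs n => [y y0|c x0 x1 y h0 IH0 h1 IH1 le_y] n.
  by rewrite big1 // => -[[|i] lti] _ /=; rewrite ?mul0r ?mulr0.
case: n => [|n].
  have := IH0 0%N; have := IH1 0%N; rewrite !big_ord0; lra.
rewrite big_ord_recl /= mul0r add0r.
rewrite (eq_bigr (fun i : 'I_n =>
  (i%:R * halt_prob (step P false (inl c)) i + halt_prob (step P false (inl c)) i
   + (i%:R * halt_prob (step P true (inl c)) i + halt_prob (step P true (inl c)) i))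
  / 2)); last first.
  by move=> i _; rewrite /= /bump add1n -(natr1 i); field.
rewrite -mulr_suml !big_split /=.
have := IH0 n; have := IH1 n.
have := sum_halt_prob_le1 n (step P false (inl c)).
have := sum_halt_prob_le1 n (step P true (inl c)).
rewrite /=; lra.
Qed.

Lemma expected_time_le b c x :
  halts_within b (inl c) x -> (expected_time R P c <= x%:E)%E.
Proof.
move=> hx; apply: lime_le.
  by apply: is_cvg_nneseries => t _ _; rewrite lee_fin mulr_ge0 // prob_timeE halt_prob_ge0.
apply: nearW => n; rewrite sumEFin lee_fin big_mkord.
under eq_bigr do rewrite prob_timeE.
exact: sum_halt_time_le hx.
Qed.

End HaltsWithin.

(** * Embedding binary trees with ordered, possibly missing, children *)

(* [Null] stands for an absent vertex. *)
Inductive btree := Null | Node of btree & btree.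

Fixpoint embeds (p q : btree) : bool :=
  match p, q with
  | Null, _ => true
  | Node _ _, Null => false
  | Node a b, Node c d =>
    embeds a c && embeds b d || embeds a d && embeds b c
  end.

Fixpoint bheight (p : btree) : nat :=
  if p is Node a b then (maxn (bheight a) (bheight b)).+1 else 0.

(** [Null] counts 1, so that a product of sizes also pays for calls on absent vertices. *)
Fixpoint bsize (p : btree) : nat :=
  if p is Node a b then (bsize a + bsize b).+1 else 1.

Section Cost.
Variable R : realType.

(* Expected cost of the lazy evaluation of [ac && bd || ad && bc], where [tac]
   is the cost of [ac], and so on. *)
Definition lazy_cost (ac bd ad : bool) (tac tbd tad tbc : R) : R :=
  tac + (if ac then tbd else 0)
  + (if ac && bd then 0 else tad + (if ad then tbc else 0)).

(* 100 is a generous bound on the number of instructions executed per pair of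
   vertices; the average is over exchanging a with b and c with d. *)
Fixpoint cost (p q : btree) : R :=
  match p, q with
  | Node a b, Node c d =>
    100 + (lazy_cost (embeds a c) (embeds b d) (embeds a d)
             (cost a c) (cost b d) (cost a d) (cost b c)
         + lazy_cost (embeds b c) (embeds a d) (embeds b d)
             (cost b c) (cost a d) (cost b d) (cost a c)
         + lazy_cost (embeds a d) (embeds b c) (embeds a c)
             (cost a d) (cost b c) (cost a c) (cost b d)
         + lazy_cost (embeds b d) (embeds a c) (embeds b c)
             (cost b d) (cost a c) (cost b c) (cost a d)) / 4
  | _, _ => 100
  end.

Lemma cost_ge0 p q : 0 <= cost p q.
Proof.
elim: p q => [|a IHa b IHb] [|c d] //=.
have := IHa c; have := IHa d; have := IHb c; have := IHb d.
by rewrite /lazy_cost; do 4!case: embeds => /=; lra.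
Qed.

Lemma cost_le_size p q : cost p q <= 100 * ((bsize p)%:R * (bsize q)%:R).
Proof.
have size_gt0 t : (1 <= bsize t)%N by case: t.
have big p' q' : 100 <= 100 * ((bsize p')%:R * (bsize q')%:R) :> R.
  by rewrite -natrM ler_peMr // ler1n muln_gt0 !size_gt0.
elim: p q => [|a IHa b IHb] [|c d]; try exact: big.
(* Whatever the order, each of the four pairs is evaluated at most once. *)
have hsum : cost (Node a b) (Node c d) <=
    100 + (cost a c + cost b d + cost a d + cost b c).
  have := cost_ge0 a c; have := cost_ge0 a d.
  have := cost_ge0 b c; have := cost_ge0 b d.
  by rewrite /= /lazy_cost; do 4!case: embeds => /=; lra.
apply: le_trans hsum _.
have := IHa c; have := IHa d; have := IHb c; have := IHb d.
rewrite /= -!natr1 !natrD.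
have := ler0n R (bsize a); have := ler0n R (bsize b).
have := ler0n R (bsize c); have := ler0n R (bsize d).
move: (_%:R : R) (_%:R : R) (_%:R : R) (_%:R : R) => xd xc xb xa.
move: (cost _ _) (cost _ _) (cost _ _) (cost _ _) => *; nra.
Qed.

(* (376, 446) is an approximate eigenvector of Saks and Wigderson's matrix
   [[9/4, 1/2], [1, 2]], whose eigenvalue ((1 + sqrt 33) / 4)^2 is slightly
   less than 2.8431; the constant -100 absorbs the additive cost, since at
   least two recursive calls are made. *)
Lemma cost_le_height p q k : (bheight p <= k)%N ->
  cost p q <= (if embeds p q then 376 else 446)
               * decimal R 2 [:: 8; 4; 3; 1]%N ^+ k - 100.
Proof.
set alpha := decimal _ _ _.
have alpha_ge1 : 1 <= alpha by rewrite /alpha /decimal /=; lra.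
(* Matrix times vector: 1069 = 9/4 * 376 + 1/2 * 446 and 1268 = 376 + 2 * 446. *)
have eig1 : 1069 <= 376 * alpha by rewrite /alpha /decimal /=; lra.
have eig0 : 1268 <= 446 * alpha by rewrite /alpha /decimal /=; lra.
elim: p q k => [|a IHa b IHb] [|c d] k.
1-3: by move=> _; have := exprn_ege1 k alpha_ge1; move: (alpha ^+ k) => /= X; lra.
case: k => // k; rewrite /= ltnS geq_max => /andP[ha hb].
have := IHa c k ha; have := IHa d k ha; have := IHb c k hb; have := IHb d k hb.
rewrite exprS.
have X_ge1 := exprn_ege1 k alpha_ge1; move: (alpha ^+ k) X_ge1 => X X_ge1.
have X_ge0 : 0 <= X by lra.
have := ler_wpM2r X_ge0 eig1; have := ler_wpM2r X_ge0 eig0.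
rewrite -!mulrA; move: (alpha * X) => Z.
move: (cost _ _) (cost _ _) (cost _ _) (cost _ _) => t1 t2 t3 t4.
by rewrite /lazy_cost; do 4!case: embeds => /=; lra.
Qed.

End Cost.

(** * The program *)

(* Registers 0 and 1 contain the addresses of the vertices p and q to compare,
   register 2 points to the tag of the topmost stack frame, register 3 contains
   0.  A call starts at 0 and returns to 32 if p embeds into q and to 61 if
   not.  The four cells below the tag of a frame contain the (randomly ordered)
   children a, b of p and c, d of q; the tag is 1 while [a c] is evaluated, 2
   during [b d] and 3 during [a d].  The last call [b c] is a tail call.  The
   bottom frame has tag 0. *)
Definition subtree_prog : program :=
  [:: (* 0 *)
      JumpEq 0 3 32; JumpEq 1 3 61;
      Read 4 0; Incr 0; Read 5 0; Read 6 1; Incr 1; Read 7 1;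
      (* 8 *)
      Flip 8; JumpEq 8 3 13; Move 9 4; Move 4 5; Move 5 9;
      (* 13 *)
      Flip 8; JumpEq 8 3 18; Move 9 6; Move 6 7; Move 7 9;
      (* 18 *)
      Incr 2; Write 2 4; Incr 2; Write 2 5; Incr 2; Write 2 6; Incr 2;
      Write 2 7; Incr 2; Const 8 1; Write 2 8;
      Move 0 4; Move 1 6; JumpEq 3 3 0;
      (* 32 *)
      Read 8 2; JumpEq 8 3 81; Const 9 1; JumpEq 8 9 46;
      Const 9 2; JumpEq 8 9 55;
      Decr 2; Decr 2; Read 1 2; Decr 2; Read 0 2; Decr 2; Decr 2;
      JumpEq 3 3 0;
      (* 46 *)
      Const 8 2; Write 2 8; Move 9 2; Decr 9; Read 1 9; Decr 9; Decr 9;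
      Read 0 9; JumpEq 3 3 0;
      (* 55 *)
      Decr 2; Decr 2; Decr 2; Decr 2; Decr 2; JumpEq 3 3 32;
      (* 61 *)
      Read 8 2; JumpEq 8 3 82; Const 9 3; JumpEq 8 9 75;
      Const 8 3; Write 2 8; Move 9 2; Decr 9; Read 1 9; Decr 9; Decr 9;
      Decr 9; Read 0 9; JumpEq 3 3 0;
      (* 75 *)
      Decr 2; Decr 2; Decr 2; Decr 2; Decr 2; JumpEq 3 3 61;
      (* 81 *)
      Answer true; Answer false].

Section Program.
Variables (R : realType) (free : nat) (m0 : nat -> nat).

(** The bound by [free] keeps both cells of every record below the stack, so pushing frames never
    damages the trees. *)
Fixpoint stored (p : nat) (t : btree) : Prop :=
  if t is Node l r then
    [/\ p <> 0%N, (p.+1 < free)%N, stored (m0 p) l & stored (m0 p.+1) r]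
  else p = 0%N.

Notation halts_in := (@halts_within R subtree_prog).

(* In continuation-passing style: if the program halts in expected time y
   from every state in which the call returns, then it does so in expected
   time y + x from the call. *)
Definition call_spec (x : R) (e : bool) (p q : nat) : Prop :=
  forall (r m : nat -> nat) (b : bool) (y : R),
    r 0%N = p -> r 1%N = q -> r 3%N = 0%N -> (free <= r 2%N)%N ->
    (forall a, (a < free)%N -> m a = m0 a) ->
    (forall r' m', r' 2%N = r 2%N -> r' 3%N = 0%N ->
       (forall a, (a <= r 2%N)%N -> m' a = m a) ->
       halts_in b (inl (Config (if e then 32%N else 61%N) r' m')) y) ->
  halts_in b (inl (Config 0%N r m)) (y + x).

Let det := @halts_within_det R subtree_prog.

Lemma updE f a x u : upd f a x u = if u == a then x else f u.
Proof. by []. Qed.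

Ltac exec :=
  apply: det; [reflexivity | cbn [step nth subtree_prog]; rewrite ?updE /= ?eqxx /=].

(* The state of a stack frame based at s, relative to the memory m below it. *)
Definition frame (m : nat -> nat) (s a b c d tag : nat) (m' : nat -> nat) :=
  [/\ forall u, (u <= s)%N -> m' u = m u,
      [/\ m' s.+1 = a, m' s.+2 = b, m' s.+3 = c & m' s.+4 = d]
    & m' s.+4.+1 = tag].

Section Frame.
Variables (m : nat -> nat) (s a b c d : nat) (ans : bool).
Hypothesis free_le : (free <= s)%N.
Hypothesis m_tree : forall u, (u < free)%N -> m u = m0 u.

Lemma frame_retag tag tag' m' : frame m s a b c d tag m' ->
  frame m s a b c d tag' (upd m' s.+4.+1 tag').
Proof.
case=> hm [h1 h2 h3 h4] h5; split; last by rewrite /upd eqxx.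
  by move=> u hu; rewrite /upd ifN ?hm //; apply/eqP; lia.
by split; rewrite /upd ifN //; apply/eqP; lia.
Qed.

(** A call preserves all cells up to its stack pointer, which is the tag of the current frame, so
    the frame survives. *)
Lemma frame_call tag m' x e p q r y : frame m s a b c d tag m' ->
  call_spec x e p q ->
  r 0%N = p -> r 1%N = q -> r 2%N = s.+4.+1 -> r 3%N = 0%N ->
  (forall r'' m'', r'' 2%N = s.+4.+1 -> r'' 3%N = 0%N ->
     frame m s a b c d tag m'' ->
     halts_in ans (inl (Config (if e then 32%N else 61%N) r'' m'')) y) ->
  halts_in ans (inl (Config 0%N r m')) (y + x).
Proof.
move=> [hm [h1 h2 h3 h4] h5] call r0 r1 r2 r3 ret.
apply: call => //; first by rewrite r2; lia.
  by move=> u hu; rewrite hm ?m_tree //; lia.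
rewrite r2 => r'' m'' r2'' r3'' hm''; apply: ret => //.
split; last by rewrite hm''.
  by move=> u hu; rewrite hm'' ?hm //; lia.
by split; rewrite hm'' //; lia.
Qed.

Ltac retag t fr :=
  have {}fr := frame_retag t fr; move: (upd _ s.+4.+1 _) fr => M fr;
  have [hm [h1 h2 h3 h4] _] := fr.

Ltac call_by fr call ret :=
  by apply: (halts_within_le (frame_call fr call _ _ _ _ ret));
    rewrite ?updE //=; lra.

Lemma first_true x e r m' y : r 2%N = s.+4.+1 -> r 3%N = 0%N ->
  frame m s a b c d 1 m' -> call_spec x e b d ->
  (forall r'' m'', r'' 2%N = s.+4.+1 -> r'' 3%N = 0%N ->
     frame m s a b c d 2 m'' ->
     halts_in ans (inl (Config (if e then 32%N else 61%N) r'' m'')) y) ->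
  halts_in ans (inl (Config 32%N r m')) (y + x + 13).
Proof.
move=> r2 r3 fr call ret; have [_ _ h5] := fr.
exec; rewrite r2 h5; exec; rewrite r3 /=.
exec; exec; exec; exec; rewrite r2; retag 2%N fr.
exec; rewrite r2; exec; exec; rewrite h4; exec; exec; exec; rewrite h2; exec.
call_by fr call ret.
Qed.

(** Failure of either conjunct of the first disjunct leads to the second disjunct, which starts with
    [[a d]]. *)
Lemma first_false tag x e r m' y : tag = 1%N \/ tag = 2%N ->
  r 2%N = s.+4.+1 -> r 3%N = 0%N ->
  frame m s a b c d tag m' -> call_spec x e a d ->
  (forall r'' m'', r'' 2%N = s.+4.+1 -> r'' 3%N = 0%N ->
     frame m s a b c d 3 m'' ->
     halts_in ans (inl (Config (if e then 32%N else 61%N) r'' m'')) y) ->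
  halts_in ans (inl (Config 61%N r m')) (y + x + 14).
Proof.
move=> tag12 r2 r3 fr call ret; have [_ _ h5] := fr.
exec; rewrite r2 h5; exec; rewrite r3.
have -> : (tag == 0)%N = false by case: tag12 => ->.
exec; exec; have -> : (tag == 3)%N = false by case: tag12 => ->.
exec; exec; rewrite r2; retag 3%N fr.
exec; rewrite r2; exec; exec; rewrite h4; exec; exec; exec; exec; rewrite h1.
exec; call_by fr call ret.
Qed.

Lemma pop_true r m' y : r 2%N = s.+4.+1 -> r 3%N = 0%N ->
  frame m s a b c d 2 m' ->
  (forall r'' m'', r'' 2%N = s -> r'' 3%N = 0%N ->
     (forall u, (u <= s)%N -> m'' u = m u) ->
     halts_in ans (inl (Config 32%N r'' m'')) y) ->
  halts_in ans (inl (Config 32%N r m')) (y + 12).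
Proof.
move=> r2 r3 [hm _ h5] ret.
exec; rewrite r2 h5; exec; rewrite r3 /=; do 4 exec.
exec; rewrite r2; do 5 exec.
by apply: (halts_within_le (ret _ _ _ _ hm)); rewrite ?updE //; lra.
Qed.

Lemma pop_false r m' y : r 2%N = s.+4.+1 -> r 3%N = 0%N ->
  frame m s a b c d 3 m' ->
  (forall r'' m'', r'' 2%N = s -> r'' 3%N = 0%N ->
     (forall u, (u <= s)%N -> m'' u = m u) ->
     halts_in ans (inl (Config 61%N r'' m'')) y) ->
  halts_in ans (inl (Config 61%N r m')) (y + 10).
Proof.
move=> r2 r3 [hm _ h5] ret.
exec; rewrite r2 h5; exec; rewrite r3 /=; do 2 exec.
exec; rewrite r2; do 5 exec.
by apply: (halts_within_le (ret _ _ _ _ hm)); rewrite ?updE //; lra.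
Qed.

(** The frame is popped before the tail call [[b c]], whose outcome is that of the whole call. *)
Lemma third_true x e r m' y : r 2%N = s.+4.+1 -> r 3%N = 0%N ->
  frame m s a b c d 3 m' -> call_spec x e b c ->
  (forall r'' m'', r'' 2%N = s -> r'' 3%N = 0%N ->
     (forall u, (u <= s)%N -> m'' u = m u) ->
     halts_in ans (inl (Config (if e then 32%N else 61%N) r'' m'')) y) ->
  halts_in ans (inl (Config 32%N r m')) (y + x + 14).
Proof.
move=> r2 r3 [hm [h1 h2 h3 h4] h5] call ret.
exec; rewrite r2 h5; exec; rewrite r3 /=; do 4 exec.
exec; rewrite r2; exec; exec; rewrite h3; exec; exec; rewrite h2; do 3 exec.
apply: (halts_within_le (call _ _ _ y _ _ _ _ _ _)); rewrite ?updE //=; last lra.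
  by move=> u hu; rewrite hm ?m_tree //; lia.
move=> r'' m'' r2'' r3'' hm''; apply: ret => // u hu.
by rewrite hm'' // hm.
Qed.

(** The overhead is at most 14 instructions for the push and 13 + 14 + 14 for the dispatches; 65
    leaves slack. *)
Lemma round_spec (ac bd ad bc : bool) (tac tbd tad tbc : R) r y :
  call_spec tac ac a c -> call_spec tbd bd b d ->
  call_spec tad ad a d -> call_spec tbc bc b c ->
  r 2%N = s -> r 3%N = 0%N ->
  r 4%N = a -> r 5%N = b -> r 6%N = c -> r 7%N = d ->
  (forall r' m', r' 2%N = s -> r' 3%N = 0%N ->
     (forall u, (u <= s)%N -> m' u = m u) ->
     halts_in ans
       (inl (Config (if ac && bd || ad && bc then 32%N else 61%N) r' m')) y) ->
  halts_in ans (inl (Config 18%N r m))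
    (y + lazy_cost ac bd ad tac tbd tad tbc + 65).
Proof.
move=> Hac Hbd Had Hbc r2 r3 ra rb rc rd ret.
exec; rewrite r2; exec; rewrite ra; exec; exec; rewrite rb; exec.
exec; rewrite rc; exec; exec; rewrite rd; do 3 exec.
set m' := (m' in Config _ _ m').
have fr : frame m s a b c d 1 m'.
  split; last by rewrite /m' updE eqxx.
    by move=> u hu; rewrite /m' !updE !ifN //; apply/eqP; lia.
  by rewrite /m' !updE; split; do ?[rewrite eqxx | rewrite ifN; last by apply/eqP; lia].
move: m' fr => m' fr.
exec; rewrite ra; exec; rewrite rc; exec.
have ad_spec tag r'' m'' : tag = 1%N \/ tag = 2%N -> ac && bd = false ->
    r'' 2%N = s.+4.+1 -> r'' 3%N = 0%N -> frame m s a b c d tag m'' ->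
    halts_in ans (inl (Config 61%N r'' m''))
      (y + (if ad then tbc else 0) + 14 + tad + 14).
  move=> tag12 acbd r2'' r3'' fr''.
  apply: first_false tag12 r2'' r3'' fr'' Had _ => r1 m1 r12 r13 fr1.
  rewrite acbd /= in ret; case: (ad) ret => /= ret.
    exact: third_true r12 r13 fr1 Hbc ret.
  by apply: (halts_within_le (pop_false r12 r13 fr1 ret)); lra.
case: (boolP ac) => hac; rewrite ?hac ?(negbTE hac) /= in Hac ret ad_spec *.
  have bd_spec r'' m'' : r'' 2%N = s.+4.+1 -> r'' 3%N = 0%N ->
      frame m s a b c d 1 m'' ->
      halts_in ans (inl (Config 32%N r'' m''))
        (y + (if bd then 0 else tad + (if ad then tbc else 0)) + 28 + tbd + 13).
    move=> r2'' r3'' fr''.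
    apply: first_true r2'' r3'' fr'' Hbd _ => r1 m1 r12 r13 fr1.
    case: (bd) ret ad_spec => /= ret ad_spec.
      by apply: (halts_within_le (pop_true r12 r13 fr1 ret)); lra.
    apply: (halts_within_le (ad_spec 2 _ _ _ _ r12 r13 fr1)) => //; first by right.
    lra.
  apply: (halts_within_le (frame_call fr Hac _ _ _ _ bd_spec)); rewrite ?updE //.
  rewrite /lazy_cost /=; lra.
have ret' r'' m'' := ad_spec 1%N r'' m'' (or_introl erefl) erefl.
apply: (halts_within_le (frame_call fr Hac _ _ _ _ ret')); rewrite ?updE //.
rewrite /lazy_cost /=; lra.
Qed.

End Frame.

Lemma cost_spec tp tq p q : stored p tp -> stored q tq ->
  call_spec (cost R tp tq) (embeds tp tq) p q.
Proof.
elim: tp tq p q => [|ta IHa tb IHb] [|tc td] p q hp hq r m ans y r0 r1 r3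
  free_le m_tree ret.
- exec; rewrite r0 r3 hp /=.
  by apply: (halts_within_le (ret _ _ _ _ _)) => //=; lra.
- exec; rewrite r0 r3 hp /=.
  by apply: (halts_within_le (ret _ _ _ _ _)) => //=; lra.
- case: hp => /eqP/negPf p0 _ _ _.
  exec; rewrite r0 r3 p0 /=; exec; rewrite r1 r3 hq /=.
  by apply: (halts_within_le (ret _ _ _ _ _)) => //=; lra.
case: hp => /eqP/negPf p0 hp ha hb; case: hq => /eqP/negPf q0 hq hc hd.
have mE u : (u.+1 < free)%N -> m u = m0 u by move=> hu; apply: m_tree; lia.
exec; rewrite r0 r3 p0 /=; exec; rewrite r1 r3 q0 /=.
exec; rewrite r0 mE //; exec; rewrite r0; exec; rewrite m_tree //.
exec; rewrite r1 mE //; exec; rewrite r1; exec; rewrite m_tree //.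
have Hac := IHa _ _ _ ha hc; have Had := IHa _ _ _ ha hd.
have Hbc := IHb _ _ _ hb hc; have Hbd := IHb _ _ _ hb hd.
rewrite [embeds _ _]/= in ret; rewrite [cost _ _ _]/=.
set l1 := lazy_cost _ _ _ (cost R ta tc) _ _ _.
set l2 := lazy_cost _ _ _ (cost R tb tc) _ _ _.
set l3 := lazy_cost _ _ _ (cost R ta td) _ _ _.
set l4 := lazy_cost _ _ _ (cost R tb td) _ _ _.
have round := round_spec free_le m_tree.
(* The two coins give the four orders averaged in [cost]. Each possible swap takes at most 5
   instructions, so the budgets 80 and 75 leave at least 70 for the 65 of [round_spec]. *)
apply: (halts_within_flip (y0 := y + (l1 + l3) / 2 + 80)
                          (y1 := y + (l2 + l4) / 2 + 80)); last lra.
- cbn [step nth subtree_prog]; exec; rewrite r3 /=.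
  apply: (halts_within_flip (y0 := y + l1 + 75) (y1 := y + l3 + 75)); last lra.
  + cbn [step nth subtree_prog]; exec; rewrite r3 /=.
    apply: (halts_within_le (round _ _ _ _ ans _ _ _ _ _ _ _ _ _ y
              Hac Hbd Had Hbc _ _ _ _ _ _ ret));
      rewrite ?updE //= -/l1; lra.
  + cbn [step nth subtree_prog]; exec; rewrite r3 /=; do 3 exec.
    (* The result is invariant under both exchanges; here and below it is rearranged to the order in
       which the pairs are tested. *)
    rewrite orbC in ret.
    apply: (halts_within_le (round _ _ _ _ ans _ _ _ _ _ _ _ _ _ y
              Had Hbc Hac Hbd _ _ _ _ _ _ ret));
      rewrite ?updE //= -/l3; lra.
- cbn [step nth subtree_prog]; exec; rewrite r3 /=; do 3 exec.
  rewrite ![embeds ta _ && _]andbC in ret.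
  apply: (halts_within_flip (y0 := y + l2 + 75) (y1 := y + l4 + 75)); last lra.
  + cbn [step nth subtree_prog]; exec; rewrite r3 /=.
    rewrite orbC in ret.
    apply: (halts_within_le (round _ _ _ _ ans _ _ _ _ _ _ _ _ _ y
              Hbc Had Hbd Hac _ _ _ _ _ _ ret));
      rewrite ?updE //= -/l2; lra.
  + cbn [step nth subtree_prog]; exec; rewrite r3 /=; do 3 exec.
    apply: (halts_within_le (round _ _ _ _ ans _ _ _ _ _ _ _ _ _ y
              Hbd Hac Hbc Had _ _ _ _ _ _ ret));
      rewrite ?updE //= -/l4; lra.
Qed.

Lemma subtree_prog_halts tp tq r :
  stored (r 0%N) tp -> stored (r 1%N) tq -> r 2%N = free -> r 3%N = 0%N ->
  m0 free = 0%N ->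
  halts_in (embeds tp tq) (inl (Config 0%N r m0)) (cost R tp tq + 3).
Proof.
move=> hp hq r2 r3 m_free.
apply: (halts_within_le (x := 3 + cost R tp tq)); last lra.
apply: (cost_spec hp hq) => //; rewrite r2 // => r' m' r2' r3' hm'.
(* The zero cell at [free] acts as the tag of the bottom frame, so the program now answers. *)
have tag0 : m' free = 0%N by rewrite hm'.
by case: (embeds tp tq); (exec; rewrite r2'; exec; rewrite r3' tag0 /=);
  apply: det => //=; apply: HaltsNow; lra.
Qed.

End Program.

(** * From rooted trees to binary trees *)

Section RootedTree.
Variable T : rtree.
Notation vertex := 'I_(nverts T).

Lemma mem_children (v c : vertex) : (c \in children v) = (parent c == Some v).
Proof. by rewrite mem_filter mem_enum andbT. Qed.

Lemma uniq_children (v : vertex) : uniq (children v).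
Proof. exact/filter_uniq/enum_uniq. Qed.

Lemma depth_root : depth (tree_root T) = 0%N.
Proof.
rewrite /depth; case: ex_minnP => d _ /(_ 0%N); rewrite /= eqxx leqn0.
by move=> /(_ isT)/eqP.
Qed.

Lemma depth_eq0 (v : vertex) : depth v = 0%N -> v = tree_root T.
Proof. by rewrite /depth; case: ex_minnP => d hd _ d0; move: hd; rewrite d0 => /eqP[]. Qed.

Lemma depth_child (v c : vertex) : parent c = Some v -> depth c = (depth v).+1.
Proof.
move=> pc; rewrite /depth; case: ex_minnP => dc hdc minc.
case: ex_minnP => dv hdv minv.
apply/eqP; rewrite eqn_leq minc; last by rewrite iterSr /= pc.
case: dc hdc {minc} => [/= /eqP[cr]|dc].
  by rewrite cr root_orphan in pc.
by rewrite iterSr /= pc => /minv.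
Qed.

Lemma iter_parent_None k : iter k (obind (@parent T)) None = None.
Proof. by elim: k => //= k ->. Qed.

Lemma depth_gt0 (c : vertex) k : depth c = k.+1 ->
  exists2 v, parent c = Some v & depth v = k.
Proof.
move=> dc; case pc: (parent c) => [v|].
  by exists v => //; move: dc; rewrite (depth_child pc) => -[].
move: dc; rewrite /depth; case: ex_minnP => -[|d] // + _ _.
by rewrite iterSr /= pc iter_parent_None.
Qed.

Definition maxdepth := (\max_(v < nverts T) depth v)%N.

Fixpoint subtree (k : nat) (v : vertex) : btree :=
  if k is k'.+1 then
    let ts := [seq subtree k' c | c <- children v] in
    Node (nth Null ts 0) (nth Null ts 1)
  else Null.

(* The fuel is just enough for the recursion not to be truncated. *)
Definition btree_at (v : vertex) := subtree (maxdepth.+1 - depth v) v.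

Definition to_btree := btree_at (tree_root T).

Lemma depth_le_max (v : vertex) : (depth v <= maxdepth)%N.
Proof. exact: leq_bigmax. Qed.

(** A child is one deeper than its parent, so its own fuel is exactly what the recursion leaves. *)
Lemma btree_atE v : btree_at v =
  Node (nth Null [seq btree_at c | c <- children v] 0)
       (nth Null [seq btree_at c | c <- children v] 1).
Proof.
rewrite {1}/btree_at subSn ?depth_le_max //=.
suff -> : [seq subtree (maxdepth - depth v) c | c <- children v]
          = [seq btree_at c | c <- children v] by [].
apply/eq_in_map => c; rewrite mem_children => /eqP pc.
by rewrite /btree_at (depth_child pc) subSS.
Qed.

Lemma child_ind (Q : vertex -> Prop) :
  (forall v, (forall c, c \in children v -> Q c) -> Q v) -> forall v, Q v.
Proof.
move=> step v; move En: (maxdepth - depth v)%N => n; elim: n v En => [|n IH] v hv;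
    apply: step => c; rewrite mem_children => /eqP/depth_child dc.
  by have := depth_le_max c; rewrite dc; lia.
by apply: IH; lia.
Qed.

(** [bheight] counts vertices whereas [height] counts edges, hence the extra 1. *)
Lemma bheight_btree_at v : (bheight (btree_at v) + depth v <= (height T).+1)%N.
Proof.
elim/child_ind: v => v IH.
have hsub i : (bheight (nth Null [seq btree_at c | c <- children v] i)
               + depth v <= height T)%N.
  have [lti|gei] := ltnP i (size (children v)).
    have mem_i := mem_nth v lti; have := IH _ mem_i.
    rewrite (nth_map v) //; move: mem_i.
    by rewrite mem_children => /eqP/depth_child ->; rewrite addnS ltnS.
  rewrite nth_default ?size_map //= add0n.
  (* [height] is a maximum over leaves only, so below an inner vertex the bound comes from an
     existing child. *)
  have [lv|] := boolP (leaf v); first exact: (leq_bigmax_cond (F := @depth T)).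
  rewrite /leaf /nilp; case E: (children v) => [|c s] // _.
  have mem_c : c \in children v by rewrite E mem_head.
  have := IH _ mem_c; move: mem_c.
  rewrite mem_children => /eqP/depth_child ->; lia.
have := hsub 0%N; have := hsub 1%N; rewrite btree_atE /=; lia.
Qed.

Lemma bheight_to_btree : (bheight to_btree <= (height T).+1)%N.
Proof. by have := bheight_btree_at (tree_root T); rewrite depth_root addn0. Qed.

Definition nth_ancestor (i : nat) (w : vertex) := iter i (obind (@parent T)) (Some w).

(* A count of the descendants of v up to distance k, with a formula for which
   disjointness of subtrees is not an issue. *)
Definition ndesc (k : nat) (v : vertex) : nat :=
  (\sum_(i < k) \sum_(w < nverts T) (nth_ancestor i w == Some v))%N.

(** The ancestor of [w] at distance [i + 1] is [v] iff the one at distance [i] is a child of [v],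
    and that child is unique. *)
Lemma ndescS k v : ndesc k.+1 v = (\sum_(c <- children v) ndesc k c).+1%N.
Proof.
rewrite /ndesc big_ord_recl -[RHS]add1n; congr addn.
  rewrite (bigD1 v) //= eqxx big1 // => w wv.
  by rewrite /nth_ancestor /=; case: eqP => // -[vw]; rewrite vw eqxx in wv.
rewrite [RHS]exchange_big /=; apply: eq_bigr => i _.
rewrite [RHS]exchange_big /=; apply: eq_bigr => w _.
rewrite add0n.
case: (nth_ancestor i w) => [c|] /=; last by rewrite big1.
under eq_bigr do rewrite (inj_eq Some_inj).
rewrite -mem_children.
have [hc|hc] := boolP (c \in children v).
  rewrite (bigD1_seq c) ?uniq_children //= eqxx big1 // => j.
  by rewrite eq_sym => /negPf ->.
rewrite big_seq big1 // => j hj; case: eqP => // cj.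
by rewrite cj hj in hc.
Qed.

Hypothesis binT : binary T.

(** A binary tree with n nodes has n + 1 missing children. *)
Lemma bsize_subtree k v : (bsize (subtree k v) <= 1 + 2 * ndesc k v)%N.
Proof.
elim: k v => [|k IH] v //=; rewrite ndescS.
have := binT v; case: (children v) => [|c [|d [|]]] //= _;
  rewrite ?big_cons ?big_nil /=; try move: (IH c); try move: (IH d); lia.
Qed.

(** Each vertex is counted at most once: the root has no parent, so it is an ancestor at one
    distance only. *)
Lemma ndesc_root k : (ndesc k (tree_root T) <= nverts T)%N.
Proof.
rewrite /ndesc exchange_big /= -[leqRHS]muln1 -[X in (X * 1)%N]card_ord -sum_nat_const.
apply: leq_sum => w _; elim: k => [|k IH]; first by rewrite big_ord0.
rewrite big_ord_recr /=; case: eqP => [wr|_]; last by rewrite addn0.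
rewrite big1 // => i _; case: eqP => // wi.
suff: nth_ancestor k w = None by rewrite wr.
rewrite /nth_ancestor -(subnK (ltn_ord i)) iterD -/(nth_ancestor i.+1 w).
rewrite /nth_ancestor iterS -/(nth_ancestor i w) wi /= root_orphan.
exact: iter_parent_None.
Qed.

Lemma bsize_to_btree : (bsize to_btree <= 1 + 2 * nverts T)%N.
Proof.
apply: leq_trans (bsize_subtree _ _) _.
by rewrite leq_add2l leq_mul2l ndesc_root orbT.
Qed.


End RootedTree.

(** * Matching the children of two vertices *)

Section ChildMatching.
Variables (V W : eqType) (F : V -> btree) (G : W -> btree).
Variables (cs : seq V) (ds : seq W).
Hypotheses (cs_le2 : (size cs <= 2)%N) (ds_le2 : (size ds <= 2)%N).
Hypothesis F_Node : forall c, c \in cs -> ~~ embeds (F c) Null.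

Let embeds_children := embeds
  (Node (nth Null [seq F c | c <- cs] 0) (nth Null [seq F c | c <- cs] 1))
  (Node (nth Null [seq G d | d <- ds] 0) (nth Null [seq G d | d <- ds] 1)).

(** [F_Node] forbids sending a present child to an absent one, and the two disjuncts are the two
    ways to match. [w0] supplies a value of [g] when there are no children. *)
Lemma embeds_matching (w0 : W) : uniq cs -> uniq ds -> embeds_children ->
  exists g : V -> W, {in cs &, injective g} /\
    {in cs, forall c, g c \in ds /\ embeds (F c) (G (g c))}.
Proof.
rewrite /embeds_children.
case: cs cs_le2 F_Node => [|c [|c' [|]]] //= _ FN ucs.
- by exists (fun=> w0); split => x.
- have /negPf FcN := FN c (mem_head _ _).
  case: ds ds_le2 => [|d [|d' [|]]] //= _ uds; rewrite ?FcN ?andbT ?orbF //=.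
  + by move=> cd; exists (fun=> d); split=> [x y|x]; rewrite !inE;
      [move=> /eqP-> /eqP-> | move=> /eqP->; rewrite eqxx].
  + by case/orP => cd; [exists (fun=> d)|exists (fun=> d')];
      (split=> [x y|x]; rewrite !inE;
        [move=> /eqP-> /eqP-> | move=> /eqP->; rewrite eqxx ?orbT]).
have /negPf FcN := FN c (mem_head _ _).
have /negPf Fc'N : ~~ embeds (F c') Null by apply: FN; rewrite !inE eqxx orbT.
case: ds ds_le2 => [|d [|d' [|]]] //= _ uds; rewrite ?FcN ?Fc'N ?andbF //=.
have dd' : d != d' by move: uds; rewrite inE andbT.
have cc' : c != c' by move: ucs; rewrite inE andbT.
case/orP => /andP[cd c'd'];
  [exists (fun x => if x == c then d else d')|exists (fun x => if x == c then d' else d)];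
  (split=> [x y|x]; rewrite !inE;
    [move=> /orP[]/eqP-> /orP[]/eqP->; rewrite ?eqxx // eq_sym (negPf cc') => /eqP;
      rewrite ?(negPf dd') // eq_sym (negPf dd')
    |move=> /orP[]/eqP->; rewrite ?eqxx ?(eq_sym c') ?(negPf cc') ?eqxx ?orbT]) => //.
Qed.

(** Absent children embed anywhere, and injectivity makes two children use both elements of [ds], so
    [g] selects a disjunct. *)
Lemma matching_embeds (g : V -> W) : uniq cs -> {in cs &, injective g} ->
  {in cs, forall c, g c \in ds /\ embeds (F c) (G (g c))} -> embeds_children.
Proof.
rewrite /embeds_children.
case: cs cs_le2 => [|c [|c' [|]]] //= _ ucs ginj gP.
  have [] := gP c (mem_head _ _).
  case: ds ds_le2 => [|d [|d' [|]]] //= _; rewrite !inE.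
    by move=> /eqP-> ->.
  by case/orP => /eqP-> ->; rewrite ?orbT.
have cc' : c != c' by move: ucs; rewrite inE andbT.
have c'_mem : c' \in [:: c; c'] by rewrite !inE eqxx orbT.
have gcc' : g c != g c'.
  by apply: contra cc' => /eqP /(ginj _ _ (mem_head _ _) c'_mem) ->.
have [] := gP c (mem_head _ _); have [] := gP c' c'_mem; move: gcc'.
case: ds ds_le2 => [|d [|d' [|]]] //= _; rewrite !inE.
  by move=> + /eqP gc' _ /eqP gc _; rewrite gc gc' eqxx.
by move=> + /orP[]/eqP gc' + /orP[]/eqP gc; rewrite gc gc' ?eqxx // => _ -> ->;
   rewrite ?orbT.
Qed.

End ChildMatching.

(** * Subtree isomorphism as embedding of binary trees *)

Section SubtreeIso.
Variables (H G : rtree).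
Hypotheses (binH : binary H) (binG : binary G).

Lemma btree_at_Node (T : rtree) (v : 'I_(nverts T)) :
  ~~ embeds (btree_at v) Null.
Proof. by rewrite btree_atE. Qed.

Lemma subtree_iso_embeds : subtree_iso H G -> embeds (to_btree H) (to_btree G).
Proof.
case=> f [f_inj f_root f_child]; rewrite /to_btree -f_root.
elim/child_ind: (tree_root H) => v IH; rewrite [btree_at v]btree_atE (btree_atE (f v)).
apply: (matching_embeds _ _ _ (g := f)) => //.
- exact: uniq_children.
- by move=> x y _ _; apply: f_inj.
- by move=> c hc; split; [apply: f_child | apply: IH].
Qed.

Lemma embeds_subtree_iso : embeds (to_btree H) (to_btree G) -> subtree_iso H G.
Proof.
move=> emb_root.
(* The embedding hypothesis sits under the existential, so that [choice] yields one matching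
   function for all pairs. *)
have match_ex (vw : 'I_(nverts H) * 'I_(nverts G)) :
    exists g : 'I_(nverts H) -> 'I_(nverts G),
    embeds (btree_at vw.1) (btree_at vw.2) ->
    {in children vw.1 &, injective g} /\
    {in children vw.1, forall c, g c \in children vw.2
      /\ embeds (btree_at c) (btree_at (g c))}.
  have [|nemb] := boolP (embeds (btree_at vw.1) (btree_at vw.2)); last first.
    by exists (fun=> tree_root G).
  rewrite [btree_at vw.1]btree_atE [btree_at vw.2]btree_atE => emb.
  have [g gP] := embeds_matching (binH _) (binG _) (fun c _ => btree_at_Node c)
    (tree_root G) (uniq_children _) (uniq_children _) emb.
  by exists g.
have [g gP] := choice match_ex.
(* The matchings are followed from the root down, with the depth as fuel. *)
pose F := fix F k v := if k is k'.+1 then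
    if parent v is Some p then g (p, F k' p) v else tree_root G
  else tree_root G.
pose f v := F (depth v) v.
have f_root : f (tree_root H) = tree_root G by rewrite /f depth_root.
have f_child p c : parent c = Some p -> f c = g (p, f p) c.
  by move=> pc; rewrite /f (depth_child pc) /= pc.
have f_emb v : embeds (btree_at v) (btree_at (f v)).
  move: {-2}v (erefl (depth v)); elim: (depth v) => [|d IH] {}v dv.
    by rewrite (depth_eq0 dv) f_root.
  have [p pv dp] := depth_gt0 dv; rewrite (f_child _ _ pv).
  have [_ /(_ v)[]//] := gP (p, f p) (IH _ dp).
  by rewrite mem_children pv.
have f_children p c : c \in children p -> f c \in children (f p).
  move=> hc; have pc : parent c = Some p by apply/eqP; rewrite -mem_children.
  by rewrite (f_child _ _ pc); have [_ /(_ c hc)[]] := gP (p, f p) (f_emb p).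
have parent_f p c : parent c = Some p -> parent (f c) = Some (f p).
  by move=> pc; apply/eqP; rewrite -mem_children f_children // mem_children pc.
have depth_f v : depth (f v) = depth v.
  move: {-2}v (erefl (depth v)); elim: (depth v) => [|d IH] {}v dv.
    by rewrite (depth_eq0 dv) f_root !depth_root.
  have [p pv dp] := depth_gt0 dv.
  by rewrite (depth_child (parent_f _ _ pv)) IH // dp.
exists f; split => // x y.
(* Equal images have equal depths; by induction the parents coincide, and the local matching
   separates siblings. *)
move: {-2}x (erefl (depth x)) y; elim: (depth x) => [|d IH] {}x dx y fxy.
  by rewrite (depth_eq0 dx) (@depth_eq0 H y) // -depth_f -fxy depth_f.
have [p px dp] := depth_gt0 dx.
have dy : depth y = d.+1 by rewrite -depth_f -fxy depth_f.
have [q qy dq] := depth_gt0 dy.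
have pq : p = q.
  apply: IH => //; apply: Some_inj.
  by rewrite -(parent_f _ _ px) -(parent_f _ _ qy) fxy.
move: fxy; rewrite (f_child _ _ px) (f_child _ _ qy) -pq.
have [ginj _] := gP (p, f p) (f_emb p); apply: ginj.
  by rewrite mem_children px.
by rewrite mem_children qy pq.
Qed.

End SubtreeIso.

(** * Memory layout *)

Lemma nth_pairs (A : Type) (f0 f1 : A -> nat) (s : seq A) a0 j i :
  (j < size s)%N -> (i < 2)%N ->
  nth 0%N (flatten [seq [:: f0 a; f1 a] | a <- s]) (2 * j + i)
  = nth 0%N [:: f0 (nth a0 s j); f1 (nth a0 s j)] i.
Proof.
elim: s j => // a s IH [|j] hj hi; first by case: i {IH} hi => [|[|]].
by rewrite (_ : 2 * j.+1 + i = (2 * j + i).+2)%N /= ?IH //; lia.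
Qed.

Lemma size_cells b T : size (cells b T) = (2 * nverts T)%N.
Proof.
rewrite /cells -[X in (2 * X)%N]card_ord cardE.
by elim: (enum _) => //= v s ->; rewrite mulnS.
Qed.

Lemma nth_cells b T (v : 'I_(nverts T)) i : (i < 2)%N ->
  nth 0%N (cells b T) (2 * v + i) = child_ptr b v i.
Proof.
move=> hi; rewrite /cells (nth_pairs _ _ v) ?size_enum_ord //.
by rewrite nth_ord_enum; case: i hi => [|[|]].
Qed.

(** As [b] is positive, no record has address 0, which is both the null pointer and the default of
    [child_ptr]. *)
Lemma stored_btree_at b T free m (v : 'I_(nverts T)) : (0 < b)%N ->
  binary T -> (addr b (nverts T) <= free)%N ->
  (forall (w : 'I_(nverts T)) i, (i < 2)%N -> m (addr b w + i)%N = child_ptr b w i) ->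
  stored free m (addr b v) (btree_at v).
Proof.
move=> b_gt0 binT free_ge mE; elim/child_ind: v => v IH.
rewrite btree_atE; split.
- by rewrite /addr; lia.
- by have := ltn_ord v; move: free_ge; rewrite /addr; lia.
- have := mE v 0%N isT; rewrite addn0 => ->; rewrite /child_ptr.
  by case: (children v) IH => [|c s] IH //; apply: IH; rewrite mem_head.
- have := mE v 1%N isT; rewrite addn1 => ->; rewrite /child_ptr.
  case: (children v) IH => [|c [|c' s]] IH //; apply: IH.
  by rewrite !inE eqxx orbT.
Qed.

Section Init.
Variables (H G : rtree).
Hypotheses (binH : binary H) (binG : binary G).
Let bG := addr 1 (nverts H).
Let free := addr bG (nverts G).

Lemma stored_H : stored free (memory (init H G)) (addr 1 (tree_root H)) (to_btree H).
Proof.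
apply: stored_btree_at => //; first by rewrite /free /bG /addr; lia.
move=> w i hi; rewrite /= {1}/addr -addnA add1n /= nth_cat size_cells.
by rewrite ifT ?nth_cells //; have := ltn_ord w; lia.
Qed.

Lemma stored_G : stored free (memory (init H G)) (addr bG (tree_root G)) (to_btree G).
Proof.
apply: stored_btree_at => // w i hi.
have -> : (addr bG w + i = (2 * nverts H + (2 * w + i)).+1)%N.
  by rewrite /bG /addr; lia.
by rewrite /= nth_cat size_cells ltnNge leq_addr /= addKn nth_cells.
Qed.

Lemma memory_free : memory (init H G) free = 0%N.
Proof.
rewrite [LHS]nth_default //= size_cat !size_cells /free /bG /addr; lia.
Qed.

Lemma init_halts (R : realType) :
  @halts_within R subtree_prog (embeds (to_btree H) (to_btree G))
    (inl (init H G)) (cost R (to_btree H) (to_btree G) + 3).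
Proof.
exact: (subtree_prog_halts R stored_H stored_G erefl erefl memory_free).
Qed.

End Init.


(** * Running time *)

Section BinaryNumerals.
Variable R : realType.
Local Notation val n := ((BinNat.N.to_nat n)%:R : R).

Lemma val_of_nat k : val (BinNat.N.of_nat k) = k%:R.
Proof. by rewrite Nnat.Nat2N.id. Qed.

Lemma val_mul m n x y : val m = x -> val n = y -> val (BinNat.N.mul m n) = x * y.
Proof. by move=> <- <-; rewrite Nnat.N2Nat.inj_mul -natrM. Qed.

Lemma val_pow m k x : val m = x ->
  val (BinNat.N.pow m (BinNat.N.of_nat k)) = x ^+ k.
Proof.
move=> <-; rewrite Nnat.N2Nat.inj_pow Nnat.Nat2N.id -natrX; congr _%:R.
by elim: k => //= k ->; rewrite expnS.
Qed.

Lemma val_digit d m x : val m = x ->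
  val (BinNat.N.add (BinNat.N.mul m (BinNat.N.of_nat 10)) (BinNat.N.of_nat d))
  = x * 10 + d%:R.
Proof.
by move=> <-; rewrite Nnat.N2Nat.inj_add Nnat.N2Nat.inj_mul !Nnat.Nat2N.id -natrM -natrD.
Qed.

Lemma val_le m n x y : BinNat.N.leb m n -> val m = x -> val n = y -> x <= y.
Proof.
move=> /BinNat.N.leb_le le_mn <- <-; rewrite ler_nat; apply/ssrnat.leP.
by move: le_mn; rewrite /BinNat.N.le Nnat.N2Nat.inj_compare PeanoNat.Nat.compare_le_iff.
Qed.

End BinaryNumerals.

(** * The exponent log2 2.8431 *)

Section Exponent.
Variable R : realType.

Let alpha : R := decimal R 2 [:: 8; 4; 3; 1]%N.

Lemma alpha_ge1 : 1 <= alpha.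
Proof. by rewrite /alpha /decimal /=; lra. Qed.

Lemma alpha_exp_le : alpha ^+ 467 <= 2 ^+ 704.
Proof.
(* The comparison takes place in binary: the numbers have about 2080 digits. *)
have alphaE : ((((2 * 10 + 8) * 10 + 4) * 10 + 3) * 10 + 1 : R) = 10 ^+ 4 * alpha.
  by rewrite /alpha /decimal /=; lra.
have digits := val_pow 467 (etrans (val_digit 1 (val_digit 3 (val_digit 4
  (val_digit 8 (val_of_nat R 2))))) alphaE).
have pow2_10 := val_mul (val_pow 704 (val_of_nat R 2)) (val_pow 1868 (val_of_nat R 10)).
(* [alpha] has four decimals and 4 * 467 = 1868. *)
have pow4_10 : (10 ^+ 4 * alpha) ^+ 467 = 10 ^+ 1868 * alpha ^+ 467.
  by rewrite exprMn -exprM; congr (10 ^+ _ * _).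
have pow10_gt0 : 0 < 10 ^+ 1868 :> R by exact: exprn_gt0.
have cancel (a b t : R) : 0 < t -> t * a <= b * t -> a <= b.
  by move=> t_gt0; rewrite mulrC ler_pM2r.
apply: (cancel _ _ _ pow10_gt0); rewrite -pow4_10.
apply: (val_le _ digits pow2_10).
by vm_compute.
Qed.

Lemma log2_alpha_ge0 : 0 <= log2 alpha.
Proof. by rewrite divr_ge0 // ln_ge0 ?alpha_ge1 //; lra. Qed.

Lemma log2_le_ratio (x : R) (p q : nat) : 0 < x -> (0 < q)%N ->
  x ^+ q <= 2 ^+ p -> log2 x <= p%:R / q%:R.
Proof.
move=> x_gt0 q_gt0.
have ln2_gt0 : 0 < ln (2 : R) by rewrite ln_gt0 //; lra.
rewrite ler_pdivrMr // mulrAC ler_pdivlMr ?ltr0n //.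
rewrite -ler_ln ?posrE ?exprn_gt0 // !lnXn //.
by rewrite mulr_natr [_ * ln 2]mulrC mulr_natr.
Qed.

(** The fraction 704/467 = 1.50749... is sharp enough to stay below both 1.507497 and 2 / 1.3267. *)
Lemma log2_alpha_le : log2 alpha <= 704 / 467.
Proof.
apply: (log2_le_ratio _ _ alpha_exp_le) => //.
exact: lt_le_trans ltr01 alpha_ge1.
Qed.

(** Base and exponent trade places: [alpha] to the power e log2 n equals n to the power e log2
    [alpha]. *)
Lemma alpha_exp_le_powR (h n : nat) (e : R) : (0 < n)%N ->
  h%:R <= e * log2 n%:R -> alpha ^+ h <= n%:R `^ (e * log2 alpha).
Proof.
move=> n_gt0 le_h.
have alpha_gt0 : 0 < alpha := lt_le_trans ltr01 alpha_ge1.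
have -> : alpha ^+ h = expR (h%:R * ln alpha).
  by rewrite expRM_natl lnK // posrE.
rewrite /powR gt_eqF ?ltr0n // ler_expR.
have -> : e * log2 alpha * ln n%:R = e * log2 n%:R * ln alpha.
  by rewrite /log2; ring.
by rewrite ler_wpM2r // ln_ge0 // alpha_ge1.
Qed.

End Exponent.

Lemma embedsP (H G : rtree) : binary H -> binary G ->
  embeds (to_btree H) (to_btree G) <-> subtree_iso H G.
Proof.
by move=> binH binG; split; [apply: embeds_subtree_iso|apply: subtree_iso_embeds].
Qed.

Lemma subtree_prog_correct (R : realType) : always_correct subtree_prog.
Proof.
move=> H G binH binG w.
have [t Ht] := halts_within_run (init_halts binH binG R) w.
exists t, (embeds (to_btree H) (to_btree G)).
by split; [exact: Ht | exact: embedsP].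
Qed.

(** * Time bounds in terms of height and size *)

Section Time.
Variable R : realType.

Let alpha : R := decimal R 2 [:: 8; 4; 3; 1]%N.

Lemma instance_gt0 K n H G : instance K n H G -> (0 < n)%N.
Proof.
case=> _ _ + _; case: n => // le_n; have := ltn_ord (tree_root H).
by rewrite ltnNge (leq_trans le_n) // muln0.
Qed.

(** Since [alpha] is below 3, the constant 1338 = 3 * 446 pays for the extra level in [h.+1]. *)
Lemma expected_time_exp K n H G h : instance K n H G -> (height H <= h)%N ->
  (expected_time R subtree_prog (init H G) <= (1338 * alpha ^+ h)%:E)%E.
Proof.
case=> binH binG _ _ le_h.
apply: le_trans (expected_time_le (init_halts binH binG R)) _; rewrite lee_fin.
have le_h1 : (bheight (to_btree H) <= h.+1)%N.
  by apply: leq_trans (bheight_to_btree H) _.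
have := @cost_le_height R _ (to_btree G) _ le_h1; rewrite -/alpha.
have : 0 <= alpha ^+ h by rewrite exprn_ge0 // (le_trans ler01) ?alpha_ge1.
rewrite exprS => X_ge0.
have : alpha * alpha ^+ h <= 3 * alpha ^+ h.
  by rewrite ler_wpM2r // /alpha /decimal /=; lra.
have : 0 <= alpha * alpha ^+ h.
  by rewrite mulr_ge0 // (le_trans ler01) ?alpha_ge1.
move: (alpha * _) => Y; move: (alpha ^+ h) X_ge0 => X.
by case: embeds; lra.
Qed.

(** Both trees have [bsize] at most 3Kn with Kn at least 1; 900 = 100 * 9, and the rest absorbs the
    additive 3. *)
Lemma expected_time_sqr K n H G : instance K n H G ->
  (expected_time R subtree_prog (init H G) <= (927 * K%:R ^+ 2 * n%:R ^+ 2)%:E)%E.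
Proof.
case=> binH binG le_H le_G.
apply: le_trans (expected_time_le (init_halts binH binG R)) _; rewrite lee_fin.
apply: le_trans (lerD (cost_le_size R _ _) (lexx _)) _.
have vH := ltn_ord (tree_root H); have vG := ltn_ord (tree_root G).
have sH : (bsize (to_btree H) <= 3 * (K * n))%N.
  by apply: leq_trans (bsize_to_btree binH) _; lia.
have sG : (bsize (to_btree G) <= 3 * (K * n))%N.
  by apply: leq_trans (bsize_to_btree binG) _; lia.
have Kn : (1 <= K * n)%N by lia.
have -> : 927 * K%:R ^+ 2 * n%:R ^+ 2 = (927 * (K * n) ^ 2)%:R :> R.
  by rewrite natrM natrX natrM; ring.
rewrite -!natrM -natrD ler_nat.
by move: sH sG; move: (bsize _) (bsize _) => x y; nia.
Qed.

Lemma expected_time_powR K n H G (e : R) : instance K n H G ->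
  (height H)%:R <= e * log2 n%:R ->
  (expected_time R subtree_prog (init H G)
    <= (1338 * n%:R `^ (e * log2 alpha))%:E)%E.
Proof.
move=> inst le_h; apply: le_trans (expected_time_exp inst (leqnn _)) _.
rewrite lee_fin; apply: ler_wpM2l; first exact: ler0n.
by apply: alpha_exp_le_powR => //; apply: instance_gt0 inst.
Qed.

End Time.

Local Open Scope classical_set_scope.

Theorem theorem1p2 (R : realType) :
  exists P : program,
    [/\ always_correct P,
        forall K : nat, exists C : R, forall (n h : nat) (H G : rtree),
          instance K n H G -> (height H <= h)%N -> (height G <= h)%N ->
          (expected_time R P (init H G)
             <= (C * Num.min ((decimal R 2 [:: 8; 4; 3; 1]%N) ^+ h) (n%:R ^+ 2))%:E)%E,
        exists2 c : R, `|c - decimal R 1 [:: 5; 0; 7]%N| < decimal R 0 [:: 0; 0; 0; 5]%N &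
          forall (K : nat) (eps : nat -> R), eps n @[n --> \oo] --> (0 : R) ->
          exists C : R, forall (n : nat) (H G : rtree),
            instance K n H G ->
            (height H)%:R <= (1 + eps n) * log2 n%:R ->
            (height G)%:R <= (1 + eps n) * log2 n%:R ->
            (expected_time R P (init H G) <= (C * n%:R `^ c)%:E)%E
      & exists2 delta : R, 0 < delta &
          forall K : nat, exists C : R, forall (n : nat) (H G : rtree),
            instance K n H G ->
            (height H)%:R <= decimal R 1 [:: 3; 2; 6; 7]%N * log2 n%:R ->
            (height G)%:R <= decimal R 1 [:: 3; 2; 6; 7]%N * log2 n%:R ->
            (expected_time R P (init H G) <= (C * n%:R `^ (2 - delta))%:E)%E].
Proof.
have L_ge0 := log2_alpha_ge0 R; have L_le := log2_alpha_le R.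
set alpha := decimal R 2 _ in L_ge0 L_le *.
(* It rounds to 1.507 yet lies strictly above 704/467, leaving room for [eps]. *)
pose c := decimal R 1 [:: 5; 0; 7; 4; 9; 7]%N.
pose e := decimal R 1 [:: 3; 2; 6; 7]%N.
have L_lt_c : 704 / 467 < c by rewrite /c /decimal /=; lra.
have c_lt2 : c < 2 by rewrite /c /decimal /=; lra.
have e_gt0 : 0 < e by rewrite /e /decimal /=; lra.
have eL_lt2 : e * (704 / 467) < 2 by rewrite /e /decimal /=; lra.
move: (704 / 467) L_le L_lt_c eL_lt2 => q L_le q_lt_c eq_lt2.
exists subtree_prog; split; first exact: (subtree_prog_correct R).
(* The sum of the two constants serves for either value of the minimum. *)
- move=> K; exists (1338 + 927 * K%:R ^+ 2) => n h H G inst le_H _.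
  have C2_ge0 : 0 <= 927 * K%:R ^+ 2 :> R by apply: mulr_ge0; [apply: ler0n|apply: exprn_ge0].
  case: (leP (alpha ^+ h) (n%:R ^+ 2)) => _.
    apply: le_trans (expected_time_exp R inst le_H) _; rewrite lee_fin; apply: ler_wpM2r.
      by rewrite exprn_ge0 // (le_trans ler01) ?alpha_ge1.
    by rewrite lerDl.
  apply: le_trans (expected_time_sqr R inst) _; rewrite lee_fin; apply: ler_wpM2r.
    exact: exprn_ge0.
  by rewrite lerDr; apply: ler0n.
- exists c; first by rewrite ltr_norml /c /decimal /=; lra.
  move=> K eps eps0.
  (* Since log2 [alpha] is at most q < 2, [eps n] below this threshold gives (1 + [eps n]) log2
     [alpha] at most q + (c - q) = c. *)
  have d_gt0 : 0 < (c - q) / 2 by lra.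
  have [N _ hN] : \forall n \near \oo, eps n < (c - q) / 2.
    exact: (cvgr_lt _ eps0).
  have C2_ge0 : 0 <= 927 * K%:R ^+ 2 :> R by apply: mulr_ge0; [apply: ler0n|apply: exprn_ge0].
  exists (1338 + 927 * K%:R ^+ 2 * N%:R ^+ 2) => n H G inst le_H _.
  have n_ge1 : 1 <= n%:R :> R by rewrite ler1n (instance_gt0 inst).
  have [le_Nn|lt_nN] := leqP N n.
    apply: le_trans (expected_time_powR inst le_H) _; rewrite lee_fin -/alpha.
    apply: ler_pM; [exact: ler0n|exact: powR_ge0| |].
      by rewrite lerDl; apply: mulr_ge0 => //; apply: exprn_ge0.
    apply: ler_powR => //; have := hN n le_Nn => /= lt_eps.
    move: (log2 _) L_ge0 L_le => L L_ge0 L_le; clearbody c; nra.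
  (* For n below [N] the quadratic bound is at most a constant. *)
  apply: le_trans (expected_time_sqr R inst) _; rewrite lee_fin.
  have nc_ge1 : 1 <= n%:R `^ c.
    rewrite -[leLHS](powRr0 n%:R) ler_powR //; lra.
  have nN : n%:R ^+ 2 <= N%:R ^+ 2 :> R.
    by rewrite lerXn2r ?nnegrE // ler_nat ltnW.
  apply: le_trans (ler_wpM2l C2_ge0 nN) _.
  have X_ge0 : 0 <= 927 * K%:R ^+ 2 * N%:R ^+ 2 :> R by apply: mulr_ge0 => //; apply: exprn_ge0.
  move: (927 * _ * _) X_ge0 => X X_ge0; nra.
(* With this choice 2 - delta = e q, which dominates e log2 [alpha]. *)
- exists (2 - e * q); first by rewrite subr_gt0.
  move=> K; exists 1338 => n H G inst le_H _.
  have n_ge1 : 1 <= n%:R :> R by rewrite ler1n (instance_gt0 inst).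
  apply: le_trans (expected_time_powR inst le_H) _.
  rewrite lee_fin -/alpha -/e; apply: ler_wpM2l; first exact: ler0n.
  apply: ler_powR => //; rewrite opprB addrC subrK.
  by apply: ler_wpM2l => //; apply: ltW.
Qed.
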